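(* Let $G$ be a weighted directed graph. Fix a vertex $w$ with $\sum_{u\in N^-(w)}w_{uw}>0$. If all incoming edge weights to $w$ are multiplied by the same constant $\lambda>0$ (all other weights being left unchanged), then the randomized zero forcing process on $G$ is unchanged, i.e. for every initial blue set the sequence of blue sets $(B_t)_{t\ge 0}$ has the same law (the same transition probabilities) for the old and for the new weights.
   Context: Randomized zero forcing (RZF): $G$ is a finite directed graph with nonnegative weights $w_{uv}$ on directed edges $(u,v)$, with $w_{uv}=0$ if there is no edge from $u$ to $v$; $N^-(w)$ is the set of in-neighbors of $w$. Start with a blue set $B_0$. Given the blue set $B_t$, each white vertex $x\notin B_t$ independently becomes blue at round $t+1$ with probability $p_t(x)=\frac{\sum_{u\in B_t}w_{ux}}{\sum_{u\in V(G)}w_{ux}}$ if the denominator is positive, and $p_t(x)=0$ otherwise; blue vertices stay blue forever. *)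

(* Defs.v *)
From HB Require Import structures.
From mathcomp Require Import all_boot all_order all_algebra.
From mathcomp Require Import all_classical all_reals all_analysis.

Set Implicit Arguments.
Unset Strict Implicit.
Unset Printing Implicit Defensive.

Import Order.TTheory GRing.Theory Num.Theory.

Local Open Scope classical_set_scope.
Local Open Scope ring_scope.

(* Self-loops are allowed: the weight of a loop at x counts in the denominator
   of the probability that x turns blue. *)
Record wdigraph (R : realType) (V : finType) := WDigraph {
  edge : rel V;
  weight : V -> V -> R;
  weight_ge0 : forall u v, 0 <= weight u v;
  weight_nonedge : forall u v, ~~ edge u v -> weight u v = 0 }.

Section randomized_zero_forcing.
Context {R : realType} {V : finType}.
Implicit Types (G : wdigraph R V) (B : {set V}).

Definition in_neighbors G (x : V) : {set V} := [set u | edge G u x]%SET.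

Definition blue_prob G B (x : V) : R :=
  if 0 < \sum_(u : V) weight G u x
  then (\sum_(u in B) weight G u x) / (\sum_(u : V) weight G u x)
  else 0.

(* The product over the white vertices expresses that, given the current blue
   set B, they turn blue independently of each other. *)
Definition rzf_trans G B B' : R :=
  if (B \subset B')%SET
  then \prod_(x | x \notin B)
         (if x \in B' then blue_prob G B x else 1 - blue_prob G B x)
  else 0.

Section scale_in.
Variables (G : wdigraph R V) (w : V) (lambda : R) (lambda_gt0 : 0 < lambda).

Definition scaled_weight (u v : V) : R :=
  if v == w then lambda * weight G u v else weight G u v.

Fact scaled_weight_ge0 u v : 0 <= scaled_weight u v.
Proof.
rewrite /scaled_weight; case: ifP => _; last exact: weight_ge0.
by rewrite mulr_ge0 ?weight_ge0// ltW.
Qed.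

Fact scaled_weight_nonedge u v : ~~ edge G u v -> scaled_weight u v = 0.
Proof.
by move=> nuv; rewrite /scaled_weight weight_nonedge// mulr0 if_same.
Qed.

Definition scale_in : wdigraph R V :=
  WDigraph scaled_weight_ge0 scaled_weight_nonedge.

End scale_in.
End randomized_zero_forcing.

HB.instance Definition _ (V : finType) :=
  isPointed.Build {set V} (finset.set0 : {set V}).
HB.instance Definition _ (V : finType) :=
  @isMeasurable.Build default_measure_display {set V}
    discrete_measurable discrete_measurable0
    discrete_measurableC discrete_measurableU.

(* The sigma-algebra on sequences of blue sets is the product one. *)
Definition coordinate_events (V : finType) : set (set (nat -> {set V})) :=
  \bigcup_t preimage_set_system setT (fun b : nat -> {set V} => b t) measurable.
Arguments coordinate_events : clear implicits.

Notation blue_seq V := (g_sigma_algebraType (coordinate_events V)).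

Section process.
Context d (T : measurableType d) (R : realType) (P : probability T R).
Context (V : finType).
Implicit Types X : nat -> {RV P >-> {set V}}.

Definition trajectory X : T -> blue_seq V := fun om t => X t om.

Fact measurable_trajectory X : measurable_fun setT (trajectory X).
Proof.
apply: (measurability (rT := blue_seq V) (coordinate_events V) erefl).
move=> _ [_ [t _ [A mA <-]] <-]; rewrite !setTI.
by rewrite -[X in measurable X]setTI; exact: (@measurable_funPT _ _ _ _ (X t)).
Qed.

HB.instance Definition _ X :=
  isMeasurableFun.Build _ _ _ _ (trajectory X) (measurable_trajectory X).

(* Conditioning on the whole past is stated in product form, so that pasts of
   probability zero need no separate treatment. *)
Definition is_rzf (G : wdigraph R V) (B0 : {set V}) X : Prop :=
  P [set om | X 0%N om = B0] = 1%E /\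
  forall (t : nat) (b : nat -> {set V}),
    P [set om | forall s, (s <= t.+1)%N -> X s om = b s] =
    (P [set om | forall s, (s <= t)%N -> X s om = b s] *
      (rzf_trans G (b t) (b t.+1))%:E)%E.

Definition rzf_law X := distribution P (trajectory X).

End process.

Arguments is_rzf {d T R} P {V} G B0 X.
Arguments rzf_law {d T R} P {V} X.

(* Main.v *)
Require Import Defs.
From mathcomp Require Import all_boot all_order all_algebra.
From mathcomp Require Import all_classical all_reals all_analysis.

Import Order.TTheory GRing.Theory Num.Theory.
Local Open Scope classical_set_scope.
Local Open Scope ring_scope.

(** In the probability that [w] turns blue, [lambda] is a common factor of the
numerator and the denominator, so scaling does not change the transition
kernel. The kernel and the initial blue set determine the probabilities of the
cylinders [B_s = b s (s < n)], which together with the empty set form a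
pi-system generating the product sigma-algebra; hence they determine the law. *)

Lemma blue_prob_scale_in (R : realType) (V : finType) (G : wdigraph R V) (w : V)
    (lambda : R) (lambda_gt0 : 0 < lambda) (B : {set V}) (x : V) :
  blue_prob (scale_in G w lambda_gt0) B x = blue_prob G B x.
Proof.
rewrite /blue_prob /= /scaled_weight; case: (x == w); last by [].
(* Since [lambda] is positive, the test for a positive denominator has the same outcome for both
   weights. *)
rewrite -!mulr_sumr pmulr_rgt0// invfM mulrACA divff ?mul1r//.
by rewrite gt_eqF.
Qed.

Lemma rzf_trans_scale_in (R : realType) (V : finType) (G : wdigraph R V) (w : V)
    (lambda : R) (lambda_gt0 : 0 < lambda) (B B' : {set V}) :
  rzf_trans (scale_in G w lambda_gt0) B B' = rzf_trans G B B'.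
Proof.
rewrite /rzf_trans; case: ifP => // _.
by apply: eq_bigr => x _; rewrite blue_prob_scale_in.
Qed.

Section cylinders.
Variable V : finType.
Implicit Types b : nat -> {set V}.

(** The strict bound makes length 0 impose no condition, so the whole space is itself a cylinder. *)
Definition cylinder n b : set (blue_seq V) :=
  [set f | forall s, (s < n)%N -> f s = b s].

Definition cylinders : set (set (blue_seq V)) :=
  [set C | C = set0 \/ exists n b, C = cylinder n b].

Lemma cylinder0 b : cylinder 0 b = setT.
Proof. by apply/seteqP; split. Qed.

(** If the prefixes agree up to [n], the longer cylinder lies in the shorter one; otherwise the two
    are disjoint. *)
Lemma cylinder_setI n m b c : (n <= m)%N ->
  cylinders (cylinder n b `&` cylinder m c).
Proof.
move=> nm; have [bc|nbc] := pselect (forall s, (s < n)%N -> b s = c s).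
  right; exists m, c; apply/seteqP; split=> [f []//|f fc]; split=> // s sn.
  by rewrite bc// fc// (leq_trans sn).
left; apply/seteqP; split=> // f [fb fc]; apply: nbc => s sn.
by rewrite -fb// fc// (leq_trans sn).
Qed.

Lemma cylinders_setI_closed : setI_closed cylinders.
Proof.
move=> _ _ [->|[n [b ->]]] [->|[m [c ->]]].
- by left; rewrite setI0.
- by left; rewrite set0I.
- by left; rewrite setI0.
- have [nm|/ltnW mn] := leqP n m; first exact: cylinder_setI.
  by rewrite setIC; exact: cylinder_setI.
Qed.

Lemma measurable_cylinder n b : measurable (cylinder n b).
Proof.
rewrite (_ : cylinder n b = \bigcap_(s in [set s | (s < n)%N])
    [set f : blue_seq V | f s = b s]); last first.
  by apply/seteqP; split=> f fb s; exact: fb.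
apply: bigcap_measurableType => s _; apply: sub_sigma_algebra.
by exists s => //; exists [set b s] => //; rewrite setTI.
Qed.

Lemma cylinders_measurable : cylinders `<=` measurable.
Proof.
by move=> _ [->|[n [b ->]]]; [exact: measurable0|exact: measurable_cylinder].
Qed.

(** As [{set V}] is finite, there are finitely many prefixes of length [t.+1], so an event about
    time [t] is a finite union of cylinders. *)
Lemma measurable_sub_cylinders :
  (measurable : set (set (blue_seq V))) `<=` <<s cylinders >>.
Proof.
apply: smallest_sub; first exact: smallest_sigma_algebra.
move=> _ [t _ [A _ <-]]; rewrite setTI.
(* Prefixes are coded by a finite type; the values of [ext h] beyond [t] are arbitrary and never
   read. *)
pose ext (h : {ffun 'I_t.+1 -> {set V}}) s := h (inord s).
rewrite (_ : _ @^-1` A = \bigcup_(h in [set h | A (ext h t)])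
    cylinder t.+1 (ext h)); last first.
  apply/seteqP; split=> [f Aft|f [h Ah /(_ t (leqnn _)) ft]]; last first.
    by rewrite /preimage/= ft.
  exists [ffun i : 'I_t.+1 => f i].
    by rewrite /= /ext ffunE inordK.
  by move=> s st; rewrite /ext ffunE inordK.
apply: (@fin_bigcup_measurable _ (g_sigma_algebraType cylinders)).
  exact: finite_finset.
by move=> h _; apply: sub_sigma_algebra; right; exists t.+1, (ext h).
Qed.

Lemma eq_probability_cylinder (R : realType)
    (mu nu : probability (blue_seq V) R) :
  (forall n b, mu (cylinder n b) = nu (cylinder n b)) ->
  forall A, measurable A -> mu A = nu A.
Proof.
move=> munu A /measurable_sub_cylinders.
(* The exhausting sequence is constantly the whole space, a cylinder of finite mass. *)
apply: (g_sigma_algebra_measure_unique _ cylinders_measurable (fun=> setT)).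
- by move=> _; right; exists 0%N, (fun=> finset.set0); rewrite cylinder0.
- by rewrite bigcup_const//; exists 0%N.
- exact: cylinders_setI_closed.
- by move=> _ [->|[n [b ->]]]; [rewrite !measure0|exact: munu].
- by move=> _; apply: (le_lt_trans (probability_le1 _ _)); rewrite ?ltry.
Qed.

End cylinders.
Arguments cylinder {V}.

Section cylinder_law.
Context d (T : measurableType d) (R : realType) (P : probability T R).
Context (V : finType) (G : wdigraph R V) (B0 : {set V}).
Variable X : nat -> {RV P >-> {set V}}.
Hypothesis rzfX : is_rzf P G B0 X.

(** Any other initial value confines the outcome to the complement of an event of probability
    one. *)
Lemma is_rzf_init (B : {set V}) :
  P [set om | X 0%N om = B] = ((B == B0)%:R)%:E.
Proof.
have mX C : measurable [set om | X 0%N om = C].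
  rewrite -[X in measurable X]setTI.
  exact: (@measurable_funPT _ _ _ _ (X 0%N) measurableT [set C]).
have [->|BB0] := eqVneq B B0; first exact: rzfX.1.
have PN0 : P (~` [set om | X 0%N om = B0]) = 0%E.
  by rewrite probability_setC// rzfX.1 subee.
apply/eqP; rewrite eq_le measure_ge0 andbT -[leRHS]PN0.
apply: le_measure; rewrite ?inE//; first exact: measurableC.
by move=> om /= -> /eqP; rewrite (negbTE BB0).
Qed.

Lemma rzf_law_cylinder n b :
  rzf_law P X (cylinder n.+1 b) =
  ((b 0%N == B0)%:R * \prod_(t < n) rzf_trans G (b t) (b t.+1))%:E.
Proof.
elim: n => [|n IHn].
  rewrite big_ord0 mulr1 -is_rzf_init; congr (P _).
  apply/seteqP; split=> om; first exact.
  by move=> omb [].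
(* The bounds [s < n.+2] and [s <= n.+1] are convertible, so the last factor is exactly the
   transition condition of [is_rzf]. *)
rewrite big_ord_recr/= mulrA EFinM -IHn; exact: rzfX.2.
Qed.

End cylinder_law.

Lemma rzf_law_unique (R : realType) (V : finType) (G : wdigraph R V)
    (B0 : {set V}) (d d' : measure_display) (T : measurableType d)
    (T' : measurableType d') (P : probability T R) (P' : probability T' R)
    (X : nat -> {RV P >-> {set V}}) (X' : nat -> {RV P' >-> {set V}}) :
  is_rzf P G B0 X -> is_rzf P' G B0 X' ->
  forall A, measurable A -> rzf_law P X A = rzf_law P' X' A.
Proof.
move=> rzfX rzfX'; apply: eq_probability_cylinder => -[|n] b.
  by rewrite cylinder0 !probability_setT.
exact: etrans (rzf_law_cylinder _ _ _ _ _ _ _ _ rzfX n b)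
  (esym (rzf_law_cylinder _ _ _ _ _ _ _ _ rzfX' n b)).
Qed.

Theorem lemma3p1 (R : realType) (V : finType) (G : wdigraph R V) (w : V)
    (hw : 0 < \sum_(u in in_neighbors G w) weight G u w)
    (lambda : R) (hlambda : 0 < lambda) :
  (forall B B' : {set V},
     rzf_trans (scale_in G w hlambda) B B' = rzf_trans G B B') /\
  (forall (B0 : {set V})
     (d d' : measure_display) (T : measurableType d) (T' : measurableType d')
     (P : probability T R) (P' : probability T' R)
     (X : nat -> {RV P >-> {set V}}) (X' : nat -> {RV P' >-> {set V}}),
     is_rzf P G B0 X -> is_rzf P' (scale_in G w hlambda) B0 X' ->
     forall A : set (blue_seq V), measurable A -> rzf_law P X A = rzf_law P' X' A).
Proof.
split=> [B B'|B0 d d' T T' P P' X X' rzfX [init' step']].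
  exact: rzf_trans_scale_in.
(* With equal kernels, [X'] is also a process for [G], so uniqueness for [G] alone applies. *)
apply: (rzf_law_unique _ _ G B0) => //; split=> // t b.
by rewrite step' rzf_trans_scale_in.
Qed.
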